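(* Let $n,r\ge 1$ and $m\ge 1$, and let $X:\mathfrak{S}_{n,r}\to\mathbb{R}$ be a colored permutation statistic of degree at most $m$. Then for every integer $k\ge 1$, the $k$th moment $\mathbb{E}_{\boldsymbol{\lambda}}[X^k]$ takes the same value on all conjugacy classes $C_{\boldsymbol{\lambda}}$ of $\mathfrak{S}_{n,r}$ that have no cycles of length $1,2,\ldots,mk$.
   Context: The colored permutation group $\mathfrak{S}_{n,r}=\mathbb{Z}_r\wr\mathfrak{S}_n$ consists of pairs $(\omega,\tau)$ with $\omega\in\mathfrak{S}_n$ and $\tau:[n]\to\mathbb{Z}_r$ (a coloring); it acts on $[n]^r=\{i^c: i\in[n],c\in\mathbb{Z}_r\}$ by $(\omega,\tau)(i^c)=\omega(i)^{\tau(\omega(i))+c}$, and the group law is composition of these bijections. A cycle of $(\omega,\tau)$ is a cycle of $\omega$; its length is its length as a cycle of $\omega$, and its color is $\sum_j \tau(j)\in\mathbb{Z}_r$ over the elements $j$ of the cycle. The cycle type is the multiset of (length, color) pairs of the cycles; it is recorded by an $r$-partition $\boldsymbol{\lambda}=(\lambda^0,\ldots,\lambda^{r-1})$ where $m_i(\lambda^c)$ is the number of cycles of length $i$ and color $c$. The conjugacy classes of $\mathfrak{S}_{n,r}$ are exactly the sets $C_{\boldsymbol{\lambda}}$ of elements of cycle type $\boldsymbol{\lambda}$. $\mathbb{E}_{\boldsymbol{\lambda}}$ denotes expectation under the uniform distribution on $C_{\boldsymbol{\lambda}}$. A partial colored permutation of size $m$ is a pair $(K,\kappa)$ where $K=\{(i_h,j_h)\}_{h=1}^m$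 is a set of $m$ ordered pairs of elements of $[n]$ with the $i_h$ distinct and the $j_h$ distinct, and $\kappa:\{j_1,\ldots,j_m\}\to\mathbb{Z}_r$. A colored permutation $(\omega,\tau)$ satisfies $(K,\kappa)$ if $\omega(i_h)=j_h$ and $\tau(j_h)=\kappa(j_h)$ for all $h$; $I_{(K,\kappa)}$ is the indicator function of this event on $\mathfrak{S}_{n,r}$. A statistic $X:\mathfrak{S}_{n,r}\to\mathbb{R}$ has degree at most $m$ if it lies in the real span of $\{I_{(K,\kappa)}\}$ over partial colored permutations of size at most $m$. *)

(* Defs.v *)
From HB Require Import structures.
From mathcomp Require Import all_boot all_order all_fingroup all_algebra.
From mathcomp Require Import reals.

Set Implicit Arguments.
Unset Strict Implicit.
Unset Printing Implicit Defensive.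

Import Order.TTheory GRing.Theory Num.Theory.

(* Z_r for r >= 1: 'I_r.-1.+1 is the cyclic group of order r for every r >= 1,
   including the trivial group when r = 1 (whereas 'Z_1 is Z/2). *)
Notation color r := 'I_r.-1.+1.

Section ColoredPermutations.
Variables n r : nat.

Record cperm := CPerm { uperm : 'S_n ; coloring : {ffun 'I_n -> color r} }.

Definition pair_of_cperm g := (uperm g, coloring g).
Definition cperm_of_pair p := CPerm p.1 p.2.
Lemma pair_of_cpermK : cancel pair_of_cperm cperm_of_pair.
Proof. by case. Qed.

HB.instance Definition _ := Equality.copy cperm (can_type pair_of_cpermK).
HB.instance Definition _ := Choice.copy cperm (can_type pair_of_cpermK).
HB.instance Definition _ := Countable.copy cperm (can_type pair_of_cpermK).
HB.instance Definition _ := Finite.copy cperm (can_type pair_of_cpermK).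

(* (x, c) stands for x^c. *)
Definition cact (g : cperm) (p : 'I_n * color r) : 'I_n * color r :=
  (uperm g p.1, (coloring g (uperm g p.1) + p.2)%R).

(* The group law is g * h = g \o h for the action [cact] (see [cactM]), whereas
   in 'S_n the product s * t applies s first. *)
Definition cperm_mul (g h : cperm) : cperm :=
  CPerm (uperm h * uperm g)
        [ffun j => coloring g j + coloring h ((uperm g)^-1%g j)]%R.
Definition cperm_one : cperm := CPerm 1 [ffun=> 0%R].
Definition cperm_inv (g : cperm) : cperm :=
  CPerm (uperm g)^-1 [ffun j => - coloring g (uperm g j)]%R.

Lemma cperm_eqP (g h : cperm) :
  uperm g = uperm h -> coloring g =1 coloring h -> g = h.
Proof. by case: g h => [s t] [s' t'] /= -> /ffunP ->. Qed.

Lemma cact_inj g h : cact g =1 cact h -> g = h.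
Proof.
move=> gh; have us : uperm g = uperm h.
  by apply/permP => x; have [] := gh (x, 0%R).
apply: cperm_eqP => // j; have /(congr1 snd) := gh ((uperm g)^-1%g j, 0%R).
by rewrite /cact /= -us permKV !addr0.
Qed.

Lemma cact_mul g h p : cact (cperm_mul g h) p = cact g (cact h p).
Proof. by rewrite /cact /= permM ffunE permK addrA. Qed.

Lemma cact_one p : cact cperm_one p = p.
Proof. by case: p => x c; rewrite /cact /= perm1 ffunE add0r. Qed.

Lemma cact_inv g p : cact (cperm_inv g) (cact g p) = p.
Proof. by case: p => x c; rewrite /cact /= permK ffunE addKr. Qed.

Fact cperm_mulA : associative cperm_mul.
Proof. by move=> g h k; apply: cact_inj => p; rewrite !cact_mul. Qed.
Fact cperm_mul1 : left_id cperm_one cperm_mul.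
Proof. by move=> g; apply: cact_inj => p; rewrite cact_mul cact_one. Qed.
Fact cperm_mulV : left_inverse cperm_one cperm_inv cperm_mul.
Proof. by move=> g; apply: cact_inj => p; rewrite cact_mul cact_one cact_inv. Qed.

HB.instance Definition _ :=
  Finite_isGroup.Build cperm cperm_mulA cperm_mul1 cperm_mulV.

Lemma cactM (g h : cperm) p : cact (g * h)%g p = cact g (cact h p).
Proof. exact: cact_mul. Qed.

Definition cycles (g : cperm) : {set {set 'I_n}} := porbits (uperm g).

Definition cycle_color (g : cperm) (C : {set 'I_n}) : color r :=
  (\sum_(j in C) coloring g j)%R.

Definition is_part (s : seq nat) := sorted geq s && (0 \notin s).

Definition is_rpartition (lam : {ffun color r -> seq nat}) :=
  [forall c, is_part (lam c)] && (\sum_c sumn (lam c) == n).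

(* [count_mem i (lam c)] is the multiplicity m_i of the part i in lam c; see
   [count_cycle_type]. *)
Definition cycle_type (g : cperm) : {ffun color r -> seq nat} :=
  [ffun c => sort geq
     [seq #|C| | C : {set 'I_n} <- enum (cycles g) & cycle_color g C == c]].

(* These sets are exactly the conjugacy classes: see [conjugacy_classP]. *)
Definition cclass (lam : {ffun color r -> seq nat}) : {set cperm} :=
  [set g | cycle_type g == lam].

Definition has_cycle_of_length (i : nat) (g : cperm) :=
  [exists C : {set 'I_n} in cycles g, #|C| == i].

(* (K, kappa) with K a set of pairs with distinct first and distinct second
   components; kappa is given as a total function, of which only the values at
   the second components of K are used in [satisfies]. *)
Definition is_partial (K : {set 'I_n * 'I_n}) :=
  dinjectiveb fst K && dinjectiveb snd K.

Definition satisfies (g : cperm) (K : {set 'I_n * 'I_n})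
    (kappa : {ffun 'I_n -> color r}) :=
  [forall p in K, (uperm g p.1 == p.2) && (coloring g p.2 == kappa p.2)].

Definition indicator (R : realType) (K : {set 'I_n * 'I_n})
    (kappa : {ffun 'I_n -> color r}) : {ffun cperm -> R^o} :=
  [ffun g => ((satisfies g K kappa)%:R)%R].

Definition indicators (R : realType) (m : nat) : seq {ffun cperm -> R^o} :=
  [seq indicator R p.1 p.2 |
    p <- enum {: {set 'I_n * 'I_n} * {ffun 'I_n -> color r}} &
    is_partial p.1 && (#|p.1| <= m)].

Definition degree_at_most (R : realType) (m : nat) (X : cperm -> R) : bool :=
  [ffun g => X g : R^o] \in <<indicators R m>>%VS.

Definition expectation (R : realType) (A : {set cperm}) (f : cperm -> R) : R :=
  ((\sum_(g in A) f g) / #|A|%:R)%R.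

End ColoredPermutations.

Section ConjugacyClasses.
Variables n r : nat.
Implicit Types (g h : cperm n r) (s : 'S_n) (t : 'I_n -> color r).
Implicit Types (bs : seq (seq 'I_n)) (lam : {ffun color r -> seq nat}).

Lemma count_cycle_type g i c :
  count_mem i (cycle_type g c) =
  #|[set C in cycles g | (#|C| == i) && (cycle_color g C == c)]|.
Proof.
rewrite ffunE (seq.permP (permEl (perm_sort _ _))) count_map count_filter.
rewrite -size_filter cardE; apply: perm_size; apply: uniq_perm.
- by apply: filter_uniq; exact: enum_uniq.
- exact: enum_uniq.
by move=> C; rewrite mem_filter !mem_enum in_set andbC.
Qed.

Lemma mem_porbit_fconnect s x y : (y \in porbit s x) = fconnect s x y.
Proof.
apply/porbitP/idP => [[i ->]|/iter_findex <-].
  by rewrite permX fconnect_iter.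
by exists (findex s x y); rewrite permX.
Qed.

(* bs lists the cycles of s, each from an arbitrary starting point. *)
Definition cycle_listing s bs :=
  [&& [::] \notin bs, perm_eq (flatten bs) (enum 'I_n) & all (fcycle s) bs].

Definition weights t bs := [seq (size b, (\sum_(j <- b) t j)%R) | b <- bs].

Lemma uniq_listing s bs : cycle_listing s bs -> uniq (flatten bs).
Proof. by case/and3P => _ /perm_uniq -> _; exact: enum_uniq. Qed.

Lemma mem_listing s bs x : cycle_listing s bs -> exists2 b, b \in bs & x \in b.
Proof.
by case/and3P => _ /perm_mem /(_ x); rewrite mem_enum => /flattenP.
Qed.

Lemma porbit_listing s bs b x : cycle_listing s bs -> b \in bs -> x \in b ->
  porbit s x = [set y in b].
Proof.
case/and3P => _ _ /allP /[apply] fb xb; apply/setP => y.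
by rewrite inE mem_porbit_fconnect (fconnect_cycle fb).
Qed.

Lemma uniq_block s bs b : cycle_listing s bs -> b \in bs -> uniq b.
Proof.
move=> /uniq_listing; elim: bs => //= b' bs IH; rewrite cat_uniq inE.
by case/and3P => ? _ /IH {}IH /predU1P[->|/IH].
Qed.

Lemma uniq_blocks s bs : cycle_listing s bs ->
  uniq [seq [set y in b] | b : seq 'I_n <- bs].
Proof.
move=> L; have := uniq_listing L; have /and3P[+ _ _] := L.
elim: bs {L} => //= b bs IH; rewrite inE negb_or cat_uniq eq_sym.
case/andP => b0 bs0 /and3P[_ nb ubs]; rewrite IH // andbT.
apply/mapP => -[b' b'bs E]; case: b b0 nb E => // x b _ /hasPn nb /setP /(_ x).
rewrite !inE eqxx /= => /esym xb'.
suff : x \in flatten bs by move/nb; rewrite mem_head.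
by apply/flattenP; exists b'.
Qed.

Lemma listing_porbits s bs : cycle_listing s bs ->
  perm_eq [seq [set y in b] | b : seq 'I_n <- bs] (enum (porbits s)).
Proof.
move=> L; apply: uniq_perm; [exact: uniq_blocks L|exact: enum_uniq|] => C.
rewrite mem_enum; apply/mapP/imsetP => [[b bbs ->]|[x _ ->]].
  case: b bbs => [|x b] bbs; first by have /and3P[/negP] := L.
  by exists x => //; rewrite (porbit_listing L bbs) // mem_head.
by have [b bbs xb] := mem_listing x L; exists b => //; apply: porbit_listing L _ _.
Qed.

Lemma cycle_typeE g bs c : cycle_listing (uperm g) bs ->
  cycle_type g c =
  sort geq [seq w.1 | w <- weights (coloring g) bs & w.2 == c].
Proof.
move=> L; rewrite ffunE; apply/perm_sortP.
- by move=> x y /=; exact: leq_total.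
- by move=> x y z /= yx zx; apply: leq_trans zx yx.
- by move=> x y /=; rewrite andbC => /anti_leq.
rewrite /cycles.
have := perm_filter (fun C => cycle_color g C == c) (listing_porbits L).
rewrite perm_sym => /(perm_map (fun C : {set 'I_n} => #|C|)) /perm_trans -> //.
rewrite filter_map /weights filter_map -!map_comp.
have E b : b \in bs -> #|[set y in b]| = size b /\
   cycle_color g [set y in b] = (\sum_(j <- b) coloring g j)%R.
  move=> bbs; have u := uniq_block L bbs; split.
    by rewrite cardsE; apply/card_uniqP.
  by rewrite /cycle_color big_uniq //=; apply: eq_bigl => j; rewrite inE.
rewrite (@eq_in_filter _ _ (fun b => (\sum_(j <- b) coloring g j == c)%R)).
  apply: (@eq_ind_r _ _ (perm_eq^~ _) (perm_refl _)).
  by apply/eq_in_map => b; rewrite mem_filter => /andP[_ /E[]].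
by move=> b /E [_] /= ->.
Qed.


Lemma cycle_listing_ex s : exists bs, cycle_listing s bs.
Proof.
exists [seq fingraph.orbit s x | x <- enum (froots s)]; apply/and3P; split.
- by apply/mapP => -[x _] /(congr1 size) /=; rewrite size_orbit -orderSpred.
- apply: uniq_perm; rewrite ?enum_uniq //; last first.
    move=> x; rewrite mem_enum inE; apply/flatten_mapP; exists (froot s x).
      by rewrite mem_enum; apply: roots_root; apply: fconnect_sym perm_inj.
    rewrite -fconnect_orbit fconnect_sym ?connect_root //; exact: perm_inj.
  have: all [in froots s] (enum (froots s)).
    by apply/allP => x; rewrite mem_enum.
  elim: (enum _) (enum_uniq (froots s)) => //= x xs IH /andP[xxs uxs].
  case/andP => rx rxs; rewrite cat_uniq orbit_uniq IH // andbT /=.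
  apply/hasPn => y /flatten_mapP [x' x'xs].
  have sC := fconnect_sym (@perm_inj _ s).
  rewrite -!fconnect_orbit => yx'; apply/negP => yx.
  case/negP: xxs; suff -> : x = x' by [].
  have /eqP <- := rx; have /eqP <- := allP rxs _ x'xs.
  by apply/(fingraph.rootP sC); apply: connect_trans yx _; rewrite sC.
by apply/allP => _ /mapP[x _ ->]; exact: cycle_orbit (@perm_inj _ s) x.
Qed.

Lemma typeP g h bs bs' : cycle_listing (uperm g) bs -> cycle_listing (uperm h) bs' ->
  (cycle_type g == cycle_type h) =
  perm_eq (weights (coloring g) bs) (weights (coloring h) bs').
Proof.
move=> L L'; have cE (W : seq (nat * color r)) l c :
    count_mem (l, c) W = count_mem l [seq w.1 | w <- W & w.2 == c].
  by rewrite count_map count_filter; apply: eq_count => -[a b]; rewrite /= -pair_eqE.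
apply/eqP/idP => [E|E]; last first.
  apply/ffunP => c; rewrite (cycle_typeE c L) (cycle_typeE c L').
  apply/perm_sortP; last by apply: perm_map; apply: perm_filter.
  - by move=> x y /=; exact: leq_total.
  - by move=> x y z /= yx zx; apply: leq_trans zx yx.
  - by move=> x y /=; rewrite andbC => /anti_leq.
apply/allP => -[l c] _ /=; rewrite !cE.
rewrite -(seq.permP (permEl (perm_sort geq _))) -(cycle_typeE c L) E.
by rewrite (cycle_typeE c L') (seq.permP (permEl (perm_sort geq _))).
Qed.

Lemma cycle_type_rpartition g : is_rpartition n (cycle_type g).
Proof.
have [bs L] := cycle_listing_ex (uperm g); apply/andP; split.
  apply/forallP => c; rewrite /is_part (cycle_typeE c L) mem_sort.
  rewrite sort_sorted /=; last by move=> x y /=; exact: leq_total.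
  apply/mapP => -[[l d]]; rewrite mem_filter => /andP[_ /mapP[b bbs [-> _]]] /= b0.
  by have /and3P[/negP[]] := L; rewrite (_ : [::] = b) //; case: b b0 {bbs}.
rewrite (eq_bigr (fun c =>
    \sum_(w <- weights (coloring g) bs | w.2 == c) w.1)); last first.
  move=> c _; rewrite (cycle_typeE c L) (perm_sumn (permEl (perm_sort _ _))).
  by rewrite sumnE big_map big_filter.
rewrite (exchange_big_dep predT) //= big_map.
rewrite (eq_bigr size) => [|b _]; last by apply: big_pred1 => c; rewrite /= eq_sym.
rewrite -(big_map size xpredT id) -sumnE -/(shape bs) -size_flatten.
by have /and3P[_ /perm_size -> _] := L; rewrite size_enum_ord.
Qed.

Lemma cycle_type_intertwine g g' h : (h * g' = g * h)%g ->
  cycle_type g' = cycle_type g.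
Proof.
move=> E; have Eu x : uperm h (uperm g' x) = uperm g (uperm h x).
  by have /(congr1 (fun k => uperm k x)) := E; rewrite /= !permM.
have Ec i : (coloring h (uperm h i) + coloring g' i =
    coloring g (uperm h i) + coloring h (uperm h ((uperm g')^-1%g i)))%R.
  have /(congr1 (fun k => coloring k (uperm h i))) := E.
  rewrite /= !ffunE permK => ->; congr (_ + coloring h _)%R.
  by apply: (canLR (permK _)); rewrite -Eu permKV.
have [bs L] := cycle_listing_ex (uperm g'); have /and3P[nb pb cb] := L.
have L' : cycle_listing (uperm g) (map (map (uperm h)) bs).
  apply/and3P; split.
  - by apply/mapP => -[[|//] bbs _]; rewrite bbs in nb.
  - rewrite -map_flatten; apply: uniq_perm; rewrite ?enum_uniq //.
      by rewrite map_inj_uniq ?(uniq_listing L) //; exact: perm_inj.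
    move=> x; rewrite mem_enum inE; apply/mapP; exists ((uperm h)^-1%g x).
      by rewrite (perm_mem pb) mem_enum.
    by rewrite permKV.
  - rewrite all_map; apply: sub_all cb => b /=; rewrite cycle_map.
    by apply: sub_cycle => x y /= /eqP <-; rewrite Eu.
apply/eqP; rewrite (typeP L L') (_ : weights _ bs = weights (coloring g) (map (map (uperm h)) bs)) //.
rewrite /weights -map_comp; apply/eq_in_map => b bbs /=; rewrite size_map big_map.
congr pair; have fb := allP cb b bbs; have ub := uniq_block L bbs.
apply: (addrI (\sum_(j <- b) coloring h (uperm h j))%R).
rewrite -big_split /= (eq_bigr _ (fun i _ => Ec i)) big_split /= addrC; congr (_ + _)%R.
have P : perm_eq (map (uperm g') b) b.
  apply: uniq_perm; rewrite ?map_inj_uniq //; try exact: perm_inj.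
  move=> x; apply/mapP/idP => [[y yb ->]|xb].
    by rewrite -(nextE fb yb) mem_next.
  exists (prev b x); first by rewrite mem_prev.
  by rewrite -(nextE fb) ?mem_prev // next_prev.
rewrite -[LHS](perm_big _ P) big_map; apply: eq_bigr => i _.
by rewrite permK.
Qed.

Lemma weights_reorder t t' bs bs' : perm_eq (weights t bs) (weights t' bs') ->
  exists2 bs'', perm_eq bs'' bs' & weights t bs = weights t' bs''.
Proof.
case/(perm_iotaP (0, 0%R)) => Is pI E; rewrite size_map in pI.
exists (map (nth [::] bs') Is).
  by rewrite -[X in perm_eq _ X](mkseq_nth [::]) perm_map.
rewrite E /weights -map_comp; apply/eq_in_map => i; rewrite (perm_mem pI).
by rewrite mem_iota /= => ib; rewrite (nth_map [::]).
Qed.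

Lemma listing_transport bs bs' s s' : cycle_listing s bs ->
  cycle_listing s' bs' -> shape bs = shape bs' ->
  exists2 f : 'S_n, map (map f) bs = bs' & forall x, f (s x) = s' (f x).
Proof.
move=> L L' sh; have u := uniq_listing L; have u' := uniq_listing L'.
have mem l x : cycle_listing l.1 l.2 -> x \in flatten l.2.
  by case/and3P => _ /perm_mem -> _; rewrite mem_enum.
have sz : size (flatten bs) = size (flatten bs') by rewrite !size_flatten sh.
pose f0 x := nth x (flatten bs') (index x (flatten bs)).
have f0_inj : injective f0.
  move=> x y; have ix := mem (s, bs) x L; have iy := mem (s, bs) y L.
  rewrite /f0 (set_nth_default x) -?sz ?index_mem // => /eqP.
  by rewrite nth_uniq -?sz ?index_mem // => /eqP/(congr1 (nth x (flatten bs))); rewrite !nth_index.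
have f0E : map f0 (flatten bs) = flatten bs'.
  case: (flatten bs) (flatten bs') @f0 {f0_inj} u sz => [|x0 p] q f0 u sz.
    by case: q sz @f0.
  apply: (@eq_from_nth _ x0) => [|i]; rewrite size_map // => ip.
  rewrite (nth_map x0) // /f0 index_uniq //.
  by apply: set_nth_default; rewrite -sz.
have fE : map (map (perm f0_inj)) bs = bs'.
  rewrite -[LHS]flattenK -[RHS]flattenK -map_flatten -sh; congr (reshape _ _).
    by rewrite /shape -map_comp; apply: eq_map => b; rewrite /= size_map.
  by rewrite -f0E; apply: eq_map => x; rewrite permE.
exists (perm f0_inj) => // x; set f := perm f0_inj in fE *.
have [b bbs xb] := mem_listing x L; have /and3P[_ _ /allP c] := L.
have /and3P[_ _ /allP c'] := L'; have fb : map f b \in bs' by rewrite -fE map_f.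
rewrite -(nextE (c _ bbs) xb) -(nextE (c' _ fb)) ?map_f //.
by rewrite next_map ?(uniq_block L) //; exact: perm_inj.
Qed.

Lemma coboundary s (d : 'I_n -> color r) :
  (forall x, \sum_(y <- fingraph.orbit s x) d y = 0)%R ->
  exists u : 'I_n -> color r, forall x, u (s x) = (u x + d (s x))%R.
Proof.
move=> d0; have s_inj := @perm_inj _ s; have sC := fconnect_sym s_inj.
pose u x := (\sum_(i < (findex s (froot s x) x).+1) d (iter i s (froot s x)))%R.
exists u => x; have Rx : froot s (s x) = froot s x.
  by apply/(fingraph.rootP sC); rewrite sC fconnect1.
rewrite /u Rx; set x0 := froot s x; have cx : fconnect s x0 x.
  by rewrite sC connect_root.
have xE := iter_findex cx; set k := findex s x0 x in xE *.
have kx : (k < fingraph.order s x0)%N := findex_max cx.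
have sxE : s x = iter k.+1 s x0 by rewrite iterS xE.
move: kx; rewrite leq_eqVlt => /predU1P[kE|kx]; last first.
  by rewrite sxE findex_iter // [LHS]big_ord_recr.
have sx0 : s x = x0 by rewrite sxE kE iter_order.
rewrite sx0 findex0 big_ord1 /= [X in (X + _)%R](_ : _ = 0%R) ?add0r //.
rewrite -[RHS](d0 x0) /fingraph.orbit (big_nth x0) big_mkord size_traject -kE.
by apply: eq_bigr => i _; rewrite nth_traject.
Qed.

Lemma cycle_type_conj g g' : cycle_type g' = cycle_type g ->
  exists h, (h * g' = g * h)%g.
Proof.
have [bs L] := cycle_listing_ex (uperm g').
have [bs0 L0] := cycle_listing_ex (uperm g).
move/eqP; rewrite (typeP L L0) => /weights_reorder[bs' pb W].
have L' : cycle_listing (uperm g) bs'.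
  have /and3P[? p c] := L0; rewrite /cycle_listing (perm_mem pb) (perm_all _ pb).
  by apply/and3P; split=> //; apply: perm_trans p; apply: perm_flatten.
have sh : shape bs = shape bs'.
  by have := congr1 (map fst) W; rewrite /weights -!map_comp.
have [f fE fs] := listing_transport L L' sh.
pose d i := (coloring g (f i) - coloring g' i)%R.
have [|u uE] := @coboundary (uperm g') d.
  move=> x; have [b bbs xb] := mem_listing x L; have /and3P[_ _ /allP c] := L.
  rewrite (perm_big b); last first.
    apply: uniq_perm; rewrite ?orbit_uniq ?(uniq_block L) // => y.
    by rewrite -fconnect_orbit (fconnect_cycle (c _ bbs)).
  rewrite /d sumrB; apply/eqP; rewrite subr_eq0; apply/eqP.
  move: W; rewrite -fE /weights -map_comp => /eq_in_map /(_ b bbs) [_ ->].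
  by rewrite big_map.
exists (CPerm f [ffun j => u (f^-1%g j)]); apply: cperm_eqP => [|j].
  by apply/permP => x; rewrite /= !permM fs.
rewrite /= !ffunE; set i := (f^-1)%g j.
have jE : j = f i by rewrite permKV.
have -> : (f^-1%g ((uperm g)^-1%g j)) = ((uperm g')^-1%g i).
  apply: (canLR (permK _)); apply: (canLR (permK _)).
  by rewrite -fs permKV.
have := uE ((uperm g')^-1%g i); rewrite permKV => ->.
by rewrite /d -jE -addrA subrK addrC.
Qed.

Lemma listed_perm bs : uniq (flatten bs) ->
  exists2 s : 'S_n, all (fcycle s) bs & forall x, x \notin flatten bs -> s x = x.
Proof.
elim: bs => [_|b bs IH] /=; first by exists 1%g => // x _; rewrite perm1.
rewrite cat_uniq => /and3P[ub /hasPn nb /IH[s cs sE]].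
pose p := perm (can_inj (prev_next ub)).
exists (s * p)%g => [|x]; last first.
  by rewrite mem_cat negb_or permM permE => /andP[xb /sE->]; rewrite next_nth (negPf xb).
apply/andP; split.
  apply: cycle_from_next => // x xb /=; rewrite permM permE sE //.
  by apply/negP => /nb; rewrite xb.
apply/allP => b' b'bs; have /allP/(_ _ b'bs) c' := cs.
have E : {in [in b'] &, frel (s * p)%g =2 frel s}.
  move=> x y xb' yb' /=; rewrite permM permE next_nth ifN //.
  apply: nb; apply/flattenP; exists b' => //.
  by rewrite -(nextE c' xb') mem_next.
by rewrite (eq_in_cycle E) //; apply/allP => y.
Qed.

Lemma listed_coloring bs (cs : seq (color r)) : [::] \notin bs ->
  uniq (flatten bs) -> size bs = size cs ->
  exists t, [seq (\sum_(j <- b) t j)%R | b : seq 'I_n <- bs] = cs.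
Proof.
elim: bs cs => [|b bs IH] [|c cs] //=; first by exists (fun=> 0%R).
rewrite inE negb_or cat_uniq => /andP[b0 bs0] /and3P[ub /hasPn nb ubs] [sz].
have [t tE] := IH cs bs0 ubs sz.
case: b b0 ub nb => // x b _ /= /andP[xb ub] nb.
exists (fun j => if j == x then c else if j \in b then 0%R else t j).
congr (_ :: _).
  rewrite big_cons eqxx big_seq big1 ?addr0 // => j jb.
  by rewrite jb ifN //; apply: contraNneq xb => <-.
rewrite -tE; apply/eq_in_map => b' b'bs; apply: eq_big_seq => j jb'.
have : j \in flatten bs by apply/flattenP; exists b'.
by move/nb; rewrite inE negb_or => /andP[/negPf-> /negPf->].
Qed.

Lemma cycle_type_surj lam : is_rpartition n lam -> exists g, cycle_type g = lam.
Proof.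
case/andP => /forallP lamP /eqP lamn.
pose ps := flatten [seq [seq (l, c) | l <- lam c] | c <- enum (color r)].
have psE c : [seq w.1 | w <- ps & w.2 == c] = lam c.
  have: c \in enum (color r) by rewrite mem_enum.
  rewrite /ps; elim: (enum _) (enum_uniq (color r)) => //= d ds IH /andP[dds uds].
  rewrite inE filter_cat map_cat filter_map -map_comp => cds.
  have notin e : e \notin ds ->
      [seq w <- flatten [seq [seq (l, c) | l <- lam c] | c <- ds] | w.2 == e] = [::].
    move=> eds; apply/eqP; rewrite -(negbK (_ == _)) -has_filter; apply/hasPn.
    move=> _ /flatten_mapP[c' c'ds /mapP[l _ ->]] /=.
    by apply: contraNneq eds => <-.
  have [->|cd] := eqVneq c d.
    rewrite notin // cats0 (@eq_filter _ _ predT) ?filter_predT => [|l] /=.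
      by rewrite (@eq_map _ _ _ id) ?map_id.
    exact: eqxx.
  rewrite (@eq_filter _ _ pred0) ?filter_pred0 => [|l] /=.
    by apply: IH => //; move: cds; rewrite (negPf cd).
  by rewrite eq_sym (negPf cd).
pose bs := reshape (unzip1 ps) (enum 'I_n).
have sps : sumn (unzip1 ps) = n.
  rewrite sumnE big_map big_flatten big_map -lamn big_enum /=.
  by apply: eq_bigr => c _; rewrite big_map sumnE.
have shE : shape bs = unzip1 ps by rewrite reshapeKl // sps size_enum_ord.
have flE : flatten bs = enum 'I_n by rewrite reshapeKr // sps size_enum_ord.
have nb : [::] \notin bs.
  apply/negP => /(map_f size); rewrite -/(shape bs) shE.
  case/mapP => _ /flatten_mapP[c _ /mapP[l lc ->]] /= l0.
  by have /andP[_ /negP[]] := lamP c; rewrite l0.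
have ub : uniq (flatten bs) by rewrite flE enum_uniq.
have [s cs _] := listed_perm ub.
have [|t tE] := @listed_coloring bs (unzip2 ps) nb ub.
  by rewrite -(size_map size bs) -/(shape bs) shE !size_map.
pose g := @CPerm n r s [ffun j => t j]; exists g.
have L : cycle_listing (uperm g) bs by rewrite /cycle_listing nb flE perm_refl.
apply/ffunP => c; rewrite (cycle_typeE c L).
have -> : weights (coloring g) bs = ps.
  rewrite -[RHS]zip_unzip -tE -shE /weights /shape zip_map; apply: eq_map => b.
  by congr pair; apply: eq_bigr => j _; rewrite ffunE.
rewrite psE; have /andP[sl _] := lamP c; apply: sorted_sort => //.
by move=> x y z /= yx zx; apply: leq_trans zx yx.
Qed.

Theorem conjugacy_classP (A : {set cperm n r}) :
  reflect (exists2 lam, is_rpartition n lam & A = cclass n lam)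
          (A \in classes [set: cperm n r]).
Proof.
have classE g : (g ^: [set: cperm n r])%g = cclass n (cycle_type g).
  apply/setP => g'; rewrite inE; apply/imsetP/eqP => [[h _ ->]|].
    by apply: (@cycle_type_intertwine _ _ h); rewrite -conjgC.
  case/cycle_type_conj => h E; exists h; rewrite ?inE //.
  by rewrite /conjg -E mulKg.
apply: (iffP imsetP) => [[g _ ->]|[lam lamP ->]].
  by exists (cycle_type g); [exact: cycle_type_rpartition|exact: classE].
by have [g <-] := cycle_type_surj lamP; exists g; rewrite ?inE ?classE.
Qed.

End ConjugacyClasses.

(* Main.v *)
(** A power [X ^+ k] is a combination of indicators of partial colored
    permutations K with at most m * k edges, so it suffices that the probability
    of K is the same for both cycle types.  We induct on the number of edges plus
    the number of non-isolated vertices of K, seen as a directed graph.  If every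
    target of an edge is the source of another one, then K contains a cycle and
    has probability 0.  Otherwise let (i, j) be an edge such that j is not a
    source, and let K0 be K without it.  The probability of K0 is the sum over
    (j', c) of the probabilities of K0 extended by the edge (i, j') colored by c.
    If j' is isolated in K0 and distinct from i, then a conjugation identifies
    this extension with K; otherwise the extension has as many edges as K, but
    fewer non-isolated vertices. *)

Require Import Defs.
From mathcomp Require Import all_boot all_order all_fingroup all_algebra.
From mathcomp Require Import reals.

Set Implicit Arguments.
Unset Strict Implicit.
Unset Printing Implicit Defensive.

Import Order.TTheory GRing.Theory Num.Theory.
Local Open Scope ring_scope.

(** * Linearity of the expectation over a set of colored permutations *)

Section Expectation.
Variables (R : realType) (n r : nat) (A : {set cperm n r}).
Implicit Types f : cperm n r -> R.

Lemma eq_expectation f1 f2 : {in A, f1 =1 f2} ->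
  expectation A f1 = expectation A f2.
Proof. by move=> f12; congr (_ / _); apply: eq_bigr. Qed.

Lemma expectation0 : expectation A (fun=> 0 : R) = 0.
Proof. by rewrite /expectation big1 ?mul0r. Qed.

Lemma expectation_cst (a : R) : A != set0 -> expectation A (fun=> a) = a.
Proof.
move=> A0; rewrite /expectation sumr_const -[a *+ _]mulr_natr mulfK //.
by rewrite pnatr_eq0 cards_eq0.
Qed.

Lemma expectationZ a f : expectation A (fun g => a * f g) = a * expectation A f.
Proof. by rewrite /expectation -mulr_sumr mulrA. Qed.

Lemma expectation_sum (I : finType) (P : pred I) (F : I -> cperm n r -> R) :
  expectation A (fun g => \sum_(i | P i) F i g) =
  \sum_(i | P i) expectation A (F i).
Proof. by rewrite /expectation exchange_big /= mulr_suml. Qed.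

End Expectation.

(** * Partial colored permutations and the events that they define *)

Section Partial.
Variables n r : nat.
Implicit Types (g h : cperm n r) (K : {set 'I_n * 'I_n}) (i j : 'I_n).
Implicit Types (kappa : {ffun 'I_n -> color r}) (c : color r).
Implicit Types lam : {ffun color r -> seq nat}.

Definition sources K := [set p.1 | p in K].
Definition targets K := [set p.2 | p in K].
Definition support K := sources K :|: targets K.

Definition recolor kappa j c : {ffun 'I_n -> color r} :=
  [ffun x => if x == j then c else kappa x].

Lemma cclass_neq0 lam : is_rpartition n lam -> cclass n lam != set0.
Proof.
by case/cycle_type_surj => g E; apply/set0Pn; exists g; rewrite inE E.
Qed.

(** Conjugation by [h] is a bijection that preserves the cycle type, so it only reindexes the
    sum. *)
Lemma expectation_conj (R : realType) lam h (f : cperm n r -> R) :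
  expectation (cclass n lam) (fun g => f (g ^ h)%g) =
  expectation (cclass n lam) f.
Proof.
congr (_ / _); rewrite [RHS](reindex_inj (@conjg_inj _ h)); apply: eq_bigl => g.
by rewrite !inE (@cycle_type_intertwine _ _ g (g ^ h)%g h) // -conjgC.
Qed.

(** Acting on color 0 records the image and its color at once, so that conjugates of [g] can be
    handled by the group law. *)
Lemma satisfiesP g K kappa :
  reflect {in K, forall p, cact g (p.1, 0) = (p.2, kappa p.2)}
          (satisfies g K kappa).
Proof.
apply: (iffP forall_inP) => sat p /sat; rewrite /cact /= addr0.
  by case/andP => /eqP -> /eqP ->.
by case=> -> ->; rewrite !eqxx.
Qed.

Lemma satisfies_partial g K kappa : satisfies g K kappa -> is_partial K.
Proof.
move/forall_inP => sat; apply/andP; split.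
all: apply/dinjectiveP => -[a b] [a' b'] /sat /andP[/eqP /= <- _].
all: move=> /sat /andP[/eqP /= <- _].
  by move=> ->.
by move/perm_inj => ->.
Qed.

(** With [satisfies_conflict], this turns a product of two indicators into a single indicator or
    zero. When the union is not partial, both sides are false. *)
Lemma satisfiesU g K1 K2 kappa1 kappa2 :
    {in targets K1 :&: targets K2, kappa1 =1 kappa2} ->
  satisfies g (K1 :|: K2)
    [ffun x => if x \in targets K1 then kappa1 x else kappa2 x] =
  satisfies g K1 kappa1 && satisfies g K2 kappa2.
Proof.
move=> agree; apply/satisfiesP/andP => [sat|[/satisfiesP s1 /satisfiesP s2] p].
  split; apply/satisfiesP => p pK; rewrite sat ?inE ?pK ?orbT // ffunE.
    by rewrite imset_f.
  case: ifP => // p1; congr pair; apply: agree.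
  by rewrite inE p1 imset_f.
rewrite inE ffunE => /orP[pK|pK]; first by rewrite imset_f ?s1.
by case: ifP => p1; rewrite s2 // agree // inE p1 imset_f.
Qed.

Lemma satisfies_conflict g K1 K2 kappa1 kappa2 j :
    j \in targets K1 -> j \in targets K2 -> kappa1 j != kappa2 j ->
  satisfies g K1 kappa1 && satisfies g K2 kappa2 = false.
Proof.
case/imsetP => p p1 -> /imsetP[q q2 E]; apply: contraNF => /andP[].
move/forall_inP/(_ p p1)/andP => [_ /eqP<-].
by move/forall_inP/(_ q q2)/andP => [_ /eqP]; rewrite -E => ->.
Qed.

(** The orbit of a source never leaves the sources, so it has at most [#|K|] elements. *)
Lemma cycle_of_closed g K kappa : satisfies g K kappa -> K != set0 ->
    targets K \subset sources K ->
  exists2 l, (1 <= l <= #|K|)%N & has_cycle_of_length l g.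
Proof.
move=> /forall_inP sat /set0Pn[p pK] /subsetP closed.
exists #|porbit (uperm g) p.1|; last first.
  by apply/exists_inP; exists (porbit (uperm g) p.1); rewrite ?imset_f.
apply/andP; split; first by apply/card_gt0P; exists p.1; exact: porbit_id.
apply: leq_trans (leq_imset_card fst (mem K)); apply: subset_leq_card.
apply/subsetP => _ /porbitP[l ->].
elim: l => [|l /imsetP[q qK E]]; first by rewrite expg0 perm1 imset_f.
rewrite expgSr permM E; have /andP[/eqP -> _] := sat q qK.
by apply: closed; rewrite imset_f.
Qed.

(** * Extending a partial colored permutation by one edge out of [i] *)

Section Extension.
Variables (K : {set 'I_n * 'I_n}) (kappa : {ffun 'I_n -> color r}) (i : 'I_n).
Hypothesis iK : i \notin sources K.

Lemma satisfies_extend g j c : j \notin targets K ->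
  satisfies g ((i, j) |: K) (recolor kappa j c) =
  satisfies g K kappa && (cact g (i, 0) == (j, c)).
Proof.
move=> jK; have E p : p \in K -> recolor kappa j c p.2 = kappa p.2.
  by move=> pK; rewrite ffunE ifN //; apply: contraNneq jK => <-; rewrite imset_f.
apply/satisfiesP/andP => [sat|[/satisfiesP sat /eqP ij] p].
  split; last by rewrite (sat (i, j)) ?setU11 // ffunE eqxx.
  by apply/satisfiesP => p pK; rewrite sat ?E // inE pK orbT.
case/setU1P => [->|pK]; first by rewrite ij ffunE eqxx.
by rewrite sat // E.
Qed.

(** If [g] satisfies [K], the only nonzero term is at [cact g (i, 0)]. Its first component is not in
    [targets K]: by injectivity of [uperm g], [i] would then be a source. *)
Lemma satisfies_sum_extensions (R : realType) g :
  (satisfies g K kappa)%:R =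
  \sum_(p : 'I_n * color r | p.1 \notin targets K)
    (satisfies g ((i, p.1) |: K) (recolor kappa p.1 p.2))%:R :> R.
Proof.
rewrite (eq_bigr (fun p => (satisfies g K kappa && (cact g (i, 0) == p))%:R)).
  have [sat|_] /= := boolP (satisfies g K kappa); last by rewrite big1.
  rewrite (bigD1 (cact g (i, 0))) /= ?eqxx.
    by rewrite big1 ?addr0 // => p /andP[_ /negPf]; rewrite eq_sym => ->.
  apply: contra iK => /imsetP[p pK] /= E.
  move/forall_inP/(_ p pK)/andP: sat => [/eqP].
  by rewrite -E => /perm_inj <- _; rewrite imset_f.
by move=> [j c] /= jK; rewrite satisfies_extend.
Qed.

(* The conjugating element fixes all (x, e) with x in the support of K or x = i,
   and maps (j', c') to (j, c). *)
Lemma expectation_extend (R : realType) lam j c j' c' :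
    j \notin support K -> j != i -> j' \notin support K -> j' != i ->
  expectation (cclass n lam)
    (fun g => (satisfies g ((i, j) |: K) (recolor kappa j c))%:R : R) =
  expectation (cclass n lam)
    (fun g => (satisfies g ((i, j') |: K) (recolor kappa j' c'))%:R).
Proof.
rewrite !inE !negb_or => /andP[js jt] ji /andP[js' jt'] ji'.
pose h : cperm n r := CPerm (tperm j j') (recolor [ffun=> 0] j (c - c')).
have hj : cact h (j', c') = (j, c).
  by rewrite /cact /= tpermR ffunE eqxx subrK.
have hx x e : x != j -> x != j' -> cact h (x, e) = (x, e).
  move=> /negPf xj xj'.
  by rewrite /cact /= tpermD 1?eq_sym ?xj // !ffunE xj add0r.
have cJ g a b : cact h a = a -> (cact (g ^ h)%g a == b) = (cact g a == cact h b).
  move=> ha; apply/eqP/eqP => [<-|E].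
    by rewrite -cactM -conjgC cactM ha.
  by rewrite /conjg !cactM ha E -cactM mulVg cact_one.
rewrite -[RHS](expectation_conj _ h); apply: eq_expectation => g _.
rewrite !satisfies_extend // cJ ?hj; last by rewrite hx // eq_sym.
congr ((_ && _)%:R); apply/satisfiesP/satisfiesP => sat p pK.
all: have ps x : x \notin sources K -> p.1 != x
  by apply: contraNneq => <-; rewrite imset_f.
all: have pt x : x \notin targets K -> p.2 != x
  by apply: contraNneq => <-; rewrite imset_f.
  by apply/eqP; rewrite cJ hx ?ps ?pt // sat.
by have /eqP := sat p pK; rewrite cJ !hx ?ps ?pt // => /eqP.
Qed.

End Extension.

End Partial.

(** * Comparison of two cycle types without short cycles *)

Section LongCycles.
Variables (R : realType) (n r N : nat) (lam mu : {ffun color r -> seq nat}).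
Hypotheses (lam_part : is_rpartition n lam) (mu_part : is_rpartition n mu).
Hypothesis lam_long : forall g i, g \in cclass n lam ->
  (1 <= i <= N)%N -> ~~ has_cycle_of_length i g.
Hypothesis mu_long : forall g i, g \in cclass n mu ->
  (1 <= i <= N)%N -> ~~ has_cycle_of_length i g.

Definition prob nu (K : {set 'I_n * 'I_n}) (kappa : {ffun 'I_n -> color r}) : R :=
  expectation (cclass n nu) (fun g => (satisfies g K kappa)%:R).

Lemma prob_eq (K : {set 'I_n * 'I_n}) kappa : (#|K| <= N)%N -> prob lam K kappa = prob mu K kappa.
Proof.
have [l] := ubnP (#|K| + #|support K|)%N.
elim: l K kappa => // l IH K kappa /ltnSE leKl KN.
have [->|K0] := eqVneq K set0.
  have E nu : is_rpartition n nu -> prob nu set0 kappa = 1.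
    move=> /cclass_neq0 nu0; rewrite -[RHS](expectation_cst _ nu0).
    apply: eq_expectation => g _; suff -> : satisfies g set0 kappa by [].
    by apply/satisfiesP => p; rewrite inE.
  by rewrite !E.
have impossible : (forall nu g, nu \in [:: lam; mu] -> g \in cclass n nu ->
    ~~ satisfies g K kappa) -> prob lam K kappa = prob mu K kappa.
  have E nu : (forall g, g \in cclass n nu -> ~~ satisfies g K kappa) ->
      prob nu K kappa = 0.
    move=> H; rewrite -[RHS](expectation0 R (cclass n nu)).
    by apply: eq_expectation => g /H /negPf ->.
  by move=> H; rewrite !E // => g; apply: H; rewrite !inE eqxx ?orbT.
(* The unions formed in [moment_eq] may fail to be partial. *)
have [Kpart|Kpart] := boolP (is_partial K); last first.
  by apply: impossible => nu g _ _; apply: contra Kpart => /satisfies_partial.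
(* Here the absence of cycles of length at most [N] enters. *)
have [closed|] := boolP (targets K \subset sources K).
  apply: impossible => nu g; rewrite !inE => nuE gnu; apply/negP => sat.
  have [i /andP[i0 iK]] := cycle_of_closed sat K0 closed.
  apply/negP; case/predU1P: nuE => [nuE|/eqP nuE].
    by apply: lam_long; rewrite ?inE -?nuE ?gnu // i0 (leq_trans iK).
  by apply: mu_long; rewrite ?inE -?nuE ?gnu // i0 (leq_trans iK).
case/subsetPn => _ /imsetP[[i j] ijK ->] /= js.
pose L := K :\ (i, j); have KE : K = (i, j) |: L by rewrite setD1K.
have LK : L \subset K by apply: subsetDl.
have [/dinjectiveP inj1 /dinjectiveP inj2] := andP Kpart.
have iL : i \notin sources L.
  apply/imsetP => -[p]; rewrite !inE => /andP[/eqP pij pK] E; apply: pij.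
  exact: inj1 pK ijK (esym E).
have jt : j \notin targets L.
  apply/imsetP => -[p]; rewrite !inE => /andP[/eqP pij pK] E; apply: pij.
  exact: inj2 pK ijK (esym E).
have ji : j != i by apply: contraNneq js => ->; apply/imsetP; exists (i, j).
have jL : j \notin support L.
  rewrite inE negb_or jt andbT; apply: contra js.
  exact/subsetP/imsetS.
have kE : recolor kappa j (kappa j) = kappa.
  by apply/ffunP => x; rewrite ffunE; case: eqP => [->|].
have cardL k : #|(i, k) |: L| = #|K|.
  have notL k' : (i, k') \in L = false.
    by apply: contraNF iL => ik; apply/imsetP; exists (i, k').
  by rewrite KE !cardsU1 !notL.
(* [Q] selects the extensions of [L] that have the same probability as [K], whatever their color. *)
pose Q (p : 'I_n * color r) := (p.1 \notin support L) && (p.1 != i).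
have rec nu : prob nu L kappa =
   prob nu K kappa *+ #|[pred p | (p.1 \notin targets L) && Q p]| +
   \sum_(p | (p.1 \notin targets L) && ~~ Q p)
     prob nu ((i, p.1) |: L) (recolor kappa p.1 p.2).
  have -> : prob nu L kappa = \sum_(p | p.1 \notin targets L)
     prob nu ((i, p.1) |: L) (recolor kappa p.1 p.2).
    rewrite -expectation_sum; apply: eq_expectation => g _.
    exact: satisfies_sum_extensions.
  rewrite (bigID Q) /= -sumr_const; congr (_ + _); apply: eq_bigr => -[j' c'] /=.
  case/and3P => _ jL' ji'; rewrite [in RHS]KE -[in RHS]kE /prob.
  exact: expectation_extend.
have suppU k : support ((i, k) |: L) = i |: (k |: support L).
  rewrite /support /sources /targets !imsetU1 /=.
  by apply/setP => x; rewrite !inE; do !case: (_ == _); rewrite ?orbT.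
(* The vertex [j] is lost when [(i, j)] is removed, even if [i] is kept. This gives the strict
   decrease in both uses of [IH]. *)
have jsupp : j \notin i |: support L by rewrite !inE negb_or ji -in_setU.
have suppK : #|support K| = #|i |: support L|.+1.
  by rewrite KE suppU setUCA cardsU1 jsupp.
have E : prob lam L kappa = prob mu L kappa.
  apply: IH; last exact: leq_trans (subset_leq_card LK) KN.
  apply: leq_trans leKl; rewrite suppK addnS ltnS; apply: leq_add.
    exact: subset_leq_card.
  by apply: subset_leq_card; apply: subsetUr.
move: E; rewrite !rec.
rewrite (eq_bigr (fun p => prob mu ((i, p.1) |: L) (recolor kappa p.1 p.2))).
  (* The equal sums cancel. The remaining multiplicity is nonzero because it counts [(j, kappa j)],
     that is, [K] itself. *)
  move/addIr/eqP; rewrite eqrMn2r => /predU1P[M0|/eqP //].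
  have /card0_eq/(_ (j, kappa j)) := M0.
  by rewrite !inE /= jt /Q jL ji.
(* As [k] is [i] or already in [support L], the extension has its support inside
   [i |: support L]. *)
move=> -[k c] /= /andP[kt].
rewrite negb_and !negbK => kQ; apply: IH; rewrite cardL //.
apply: leq_trans leKl; rewrite suppK addnS ltnS leq_add2l suppU.
apply: subset_leq_card; apply/subsetP => x; rewrite !in_setU1.
by case/or3P => [->//|/eqP->|->]; rewrite ?orbT // orbC.
Qed.

(** The extra indicator makes the induction on [k] work: each factor [X] is expanded and absorbed
    into [K], at a cost of at most [m] edges. *)
Lemma moment_eq m (X : cperm n r -> R) k (K : {set 'I_n * 'I_n}) kappa :
    degree_at_most m X ->
    (#|K| + m * k <= N)%N ->
  expectation (cclass n lam) (fun g => X g ^+ k * (satisfies g K kappa)%:R) =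
  expectation (cclass n mu) (fun g => X g ^+ k * (satisfies g K kappa)%:R).
Proof.
move=> degX; elim: k K kappa => [|k IH] K kappa KN.
  have E nu : expectation (cclass n nu)
      (fun g => X g ^+ 0 * (satisfies g K kappa)%:R) = prob nu K kappa.
    by apply: eq_expectation => g _; rewrite mul1r.
  by rewrite !E prob_eq // (leq_trans _ KN) // leq_addr.
(* The coefficients depend on [X] alone, hence are the same for both classes. *)
pose I := in_tuple (indicators n r R m).
have XE g : X g = \sum_i coord I i [ffun g => X g : R^o] * I`_i g.
  have /(congr1 (fun F : {ffun cperm n r -> R^o} => F g)) :=
    coord_span (X := I) degX.
  by rewrite ffunE sum_ffunE => ->; apply: eq_bigr => i _; rewrite ffunE.
have E nu : expectation (cclass n nu)
      (fun g => X g ^+ k.+1 * (satisfies g K kappa)%:R) =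
    \sum_i coord I i [ffun g => X g : R^o] * expectation (cclass n nu)
      (fun g => X g ^+ k * (I`_i g * (satisfies g K kappa)%:R)).
  under [RHS]eq_bigr do rewrite -expectationZ.
  rewrite -expectation_sum; apply: eq_expectation => g _.
  rewrite exprSr [X in _ * X * _]XE -mulrA mulr_suml mulr_sumr.
  by apply: eq_bigr => i _; rewrite -mulrA mulrCA.
rewrite !E; apply: eq_bigr => i _; congr (_ * _).
have : I`_i \in indicators n r R m by rewrite mem_nth ?ltn_ord.
case/mapP => -[K' kappa']; rewrite mem_filter => /andP[/andP[_ /= K'm] _] ->.
have [agree|] := boolP
  [forall (x | x \in targets K' :&: targets K), kappa' x == kappa x].
  have agr : {in targets K' :&: targets K, kappa' =1 kappa}.
    by move=> x xK; apply/eqP; move/forall_inP: agree; apply.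
  have {}E nu : expectation (cclass n nu)
     (fun g => X g ^+ k * (indicator R K' kappa' g * (satisfies g K kappa)%:R)) =
   expectation (cclass n nu) (fun g => X g ^+ k * (satisfies g (K' :|: K)
     [ffun x => if x \in targets K' then kappa' x else kappa x])%:R).
    apply: eq_expectation => g _; rewrite ffunE satisfiesU //.
    by rewrite -natrM mulnb.
  rewrite !E IH //; apply: leq_trans KN.
  rewrite mulnS addnCA addnA leq_add2r (leq_trans (leq_card_setU _ _)) //.
  by rewrite leq_add2r.
rewrite negb_forall_in => /exists_inP[x]; rewrite inE => /andP[x' xK] neq.
have {}E nu : expectation (cclass n nu)
   (fun g => X g ^+ k * (indicator R K' kappa' g * (satisfies g K kappa)%:R)) = 0.
  rewrite -[RHS](expectation0 R (cclass n nu)); apply: eq_expectation => g _.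
  by rewrite ffunE -natrM mulnb (satisfies_conflict _ x' xK neq) mulr0.
by rewrite !E.
Qed.

End LongCycles.

Theorem theorem1p1 (R : realType) (n r m : nat)
    (hn : (0 < n)%N) (hr : (0 < r)%N) (hm : (0 < m)%N)
    (X : cperm n r -> R) (hX : degree_at_most m X)
    (k : nat) (hk : (0 < k)%N)
    (lam mu : {ffun color r -> seq nat})
    (hlam : is_rpartition n lam) (hmu : is_rpartition n mu)
    (lam_long : forall g i, g \in cclass n lam ->
       (1 <= i <= m * k)%N -> ~~ has_cycle_of_length i g)
    (mu_long : forall g i, g \in cclass n mu ->
       (1 <= i <= m * k)%N -> ~~ has_cycle_of_length i g) :
  expectation (cclass n lam) (fun g => (X g ^+ k)%R) =
  expectation (cclass n mu) (fun g => (X g ^+ k)%R).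
Proof.
(* The empty set of edges has indicator 1 and starts the edge count at 0. *)
have E nu : expectation (cclass n nu) (fun g => X g ^+ k) =
    expectation (cclass n nu)
      (fun g => X g ^+ k * (satisfies g set0 [ffun=> 0])%:R).
  apply: eq_expectation => g _; suff -> : satisfies g set0 [ffun=> 0].
    by rewrite mulr1.
  by apply/satisfiesP => p; rewrite inE.
rewrite !E; apply: (moment_eq hlam hmu lam_long mu_long _ hX).
by rewrite cards0.
Qed.
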